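(* Let $p\geq 1$ be a real number, let $\mathbb{D}$ be the open unit disc of $\mathbb{C}$ and let $v_p(z)=(1-|z|^2)^p$ for $z\in\mathbb{D}$. Then $H^\infty_{v_pK}(\mathbb{D},F)$ has the $WH^\infty$-BPB property for every complex Banach space $F$.
   Context: Notation: $B_X$, $S_X$ are the closed unit ball and unit sphere of a Banach space $X$; $\mathbb{T}$ is the unit circle of $\mathbb{C}$. A weight on an open set $U$ is a strictly positive continuous function on $U$. $H^\infty_v(U,F)$ is the Banach space of holomorphic mappings $f:U\to F$ with $\|f\|_v:=\sup\{v(z)\|f(z)\|: z\in U\}<\infty$; $H^\infty_v(U):=H^\infty_v(U,\mathbb{C})$. $H^\infty_{vK}(U,F)$ is the subspace of all $f\in H^\infty_v(U,F)$ such that $vf$ has relatively compact range in $F$, with the norm $\|\cdot\|_v$. $G^\infty_v(U)$ is the space of all linear functionals on $H^\infty_v(U)$ whose restriction to $B_{H^\infty_v(U)}$ is continuous for the compact-open topology; it is a closed subspace of $H^\infty_v(U)^*$, with the norm of $H^\infty_v(U)^*$. For $z\in U$, $\delta_z\in G^\infty_v(U)$ is the evaluation $\delta_z(f)=f(z)$. $WH^\infty$-BPB property: a linear subspace $A\subseteq H^\infty_v(U,F)$ has the $WH^\infty$-BPB property if for every $0<\varepsilon<1$ there is $0<\eta(\varepsilon)<\varepsilon$ such that for every $f\in S_A$, every $\lambda\in\mathbb{T}$ and every $z\in U$ with $v(z)\|f(z)\|>1-\eta(\varepsilon)$, there exist $f_0\in S_A$, $\lambda_0\in\mathbb{T}$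 and $z_0\in U$ such that $v(z_0)\|f_0(z_0)\|=1$, $\|f-f_0\|_v<\varepsilon$ and $\|\lambda v(z)\delta_z-\lambda_0v(z_0)\delta_{z_0}\|<\varepsilon$ (the last norm being that of $G^\infty_v(U)$). *)

(* Defs.v *)
From HB Require Import structures.
From mathcomp Require Import all_boot all_order all_algebra.
From mathcomp Require Import all_classical all_reals all_analysis.
From mathcomp Require Export complex.

Set Implicit Arguments.
Unset Strict Implicit.
Unset Printing Implicit Defensive.

Import Order.TTheory GRing.Theory Num.Theory.

Local Open Scope classical_set_scope.
Local Open Scope complex_scope.
Local Open Scope ring_scope.

(* [R[i]] carries a normed-module structure over itself through the
   regular-module alias [_^o]. *)
Notation Cplx R := ((R[i])^o).

(* In a normed module over [R[i]] the norm [`|x|] is a nonnegative real element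
   of [R[i]]; [rnorm x] is the same number as an element of [R]. *)
Definition rnorm (R : realType) (V : normedModType R[i]) (x : V) : R :=
  complex.Re `|x|.

Section WeightedSpaces.
Context {R : realType} {E : normedModType R[i]}.

(* Mappings on [U] are represented by total functions on [E]: every notion below
   only depends on the values taken on [U] (which is meant to be open). *)
Implicit Types (U : set E) (v : E -> R).

Definition holomorphic_on (F : normedModType R[i]) U (f : E -> F) : Prop :=
  forall z, U z -> differentiable f z.

Definition wnorm (F : normedModType R[i]) U v (f : E -> F) : \bar R :=
  ereal_sup [set (v z * rnorm (f z))%:E | z in U].

Definition Hinf (F : normedModType R[i]) U v : set (E -> F) :=
  [set f | holomorphic_on U f /\ (wnorm U v f < +oo)%E].

Definition HinfK (F : normedModType R[i]) U v : set (E -> F) :=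
  [set f | Hinf U v f /\ precompact [set (v z)%:C *: f z | z in U]].

Definition wsphere (F : normedModType R[i]) U v (A : set (E -> F)) :
    set (E -> F) :=
  [set f | A f /\ wnorm U v f = 1%E].

(* The norm of the dual of the scalar space [Hinf U v], hence also that of its
   closed subspace of functionals which are continuous on the unit ball for the
   compact-open topology. *)
Definition dual_norm U v (phi : (E -> Cplx R) -> Cplx R) : \bar R :=
  ereal_sup [set (rnorm (phi g))%:E |
    g in [set g : E -> Cplx R | Hinf U v g /\ (wnorm U v g <= 1)%E]].

Definition evalf (z : E) : (E -> Cplx R) -> Cplx R := fun g => g z.

Definition WHinf_BPB (F : normedModType R[i]) U v (A : set (E -> F)) : Prop :=
  forall eps : R, 0 < eps < 1 ->
  exists2 eta : R, 0 < eta < eps &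
  forall (f : E -> F) (lam : Cplx R) (z : E),
    wsphere U v A f -> rnorm lam = 1 -> U z -> 1 - eta < v z * rnorm (f z) ->
  exists (f0 : E -> F) (lam0 : Cplx R) (z0 : E),
    [/\ wsphere U v A f0, rnorm lam0 = 1 & U z0] /\
    [/\ v z0 * rnorm (f0 z0) = 1,
        (wnorm U v (f \- f0)%R < eps%:E)%E &
        (dual_norm U v (fun g => lam * (v z)%:C * evalf z g
                                  - lam0 * (v z0)%:C * evalf z0 g)%R < eps%:E)%E].

End WeightedSpaces.

Definition unit_disc (R : realType) : set (Cplx R) := [set z | rnorm z < 1].

Definition vdisc (R : realType) (p : R) (z : Cplx R) : R :=
  (1 - rnorm z ^+ 2) `^ p.

Arguments unit_disc R : clear implicits.

(* Main.v *)
From HB Require Import structures.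
Require Import Defs.
From mathcomp Require Import all_boot all_order all_algebra.
From mathcomp Require Import all_classical all_reals all_analysis.
From mathcomp Require Import ring lra zify.

(* Near its maximum, f is perturbed by a multiple of a peak function h at z:
   h = (vdisc p z)^-1 (1 + zeta)^-q, where zeta(w) is a multiple of
   conj(z) (w - z) / (1 - |z|^2) chosen so that v|h| is critical at z. Any
   natural q > 2p will do, so no complex power is needed: by Bernoulli's
   inequality, v|h| is at most 1 and, uniformly in z, it is bounded away from 1
   when |w - z| >= r (1 - |z|^2). Hence the weighted norm of the perturbed
   mapping is attained, at a point z0 of a square of size about
   r (1 - |z|^2) around z, and one may take lambda0 = lambda.

   That v(z) delta_z and v(z0) delta_z0 are then close amounts to a uniform
   Lipschitz estimate for the holomorphic functions bounded by 1/v, i.e. to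
   Cauchy's estimate. It is obtained from Goursat's argument on squares, with
   midpoint Riemann sums over the 2^n-fold subdivisions of the sides instead of
   contour integrals: these sums are exactly additive when a square is cut into
   four (with n decreasing by one) and vanish on affine functions, which is all
   that Goursat's argument uses. *)

Set Implicit Arguments.
Unset Strict Implicit.
Unset Printing Implicit Defensive.

Import Order.TTheory GRing.Theory Num.Theory.
Import numFieldNormedType.Exports.

Local Open Scope classical_set_scope.
Local Open Scope complex_scope.
Local Open Scope ring_scope.

(** * Real-valued norms in modules over the complex numbers *)

Section RealNorm.
Variable R : realType.
Section Module.
Variable V : normedModType R[i].
Implicit Types x y : V.

Lemma normE x : `|x| = (rnorm x)%:C.
Proof. by rewrite /rnorm RRe_real// ger0_real. Qed.

Lemma rnorm_ge0 x : 0 <= rnorm x.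
Proof. by rewrite -ler0c -normE. Qed.

Lemma rnorm0 : rnorm (0 : V) = 0.
Proof. by rewrite /rnorm normr0. Qed.

Lemma rnorm0_eq0 x : rnorm x = 0 -> x = 0.
Proof. by move=> x0; apply/eqP; rewrite -normr_eq0 normE x0. Qed.

Lemma rnormN x : rnorm (- x) = rnorm x.
Proof. by rewrite /rnorm normrN. Qed.

Lemma rnorm_distC x y : rnorm (x - y) = rnorm (y - x).
Proof. by rewrite /rnorm distrC. Qed.

Lemma rnormD x y : rnorm (x + y) <= rnorm x + rnorm y.
Proof. by have := ler_normD x y; rewrite !normE -rmorphD lecR. Qed.

Lemma rnormB x y : rnorm (x - y) <= rnorm x + rnorm y.
Proof. by rewrite -[rnorm y]rnormN rnormD. Qed.

End Module.

Lemma rnormZ (V : normedModType R[i]) (c : R[i]) (x : V) :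
  rnorm (c *: x) = rnorm (c : Cplx R) * rnorm x.
Proof.
have := normrZ c x; rewrite !normE [X in X * _](_ : _ = (rnorm (c : Cplx R))%:C).
  by rewrite -rmorphM => /complexI.
exact: (@normE (Cplx R)).
Qed.

Implicit Types z w : R[i].
Local Notation nm z := (rnorm (z : Cplx R)).

Lemma rnorm1 : nm 1 = 1.
Proof. by rewrite /rnorm normr1. Qed.

Lemma rnormM z w : nm (z * w) = nm z * nm w.
Proof. exact: (rnormZ (V := Cplx R)). Qed.

Lemma rnormX z n : nm (z ^+ n) = nm z ^+ n.
Proof. by elim: n => [|n IH]; rewrite ?expr0 ?rnorm1// !exprS rnormM IH. Qed.

Lemma rnormV z : nm z^-1 = (nm z)^-1.
Proof.
have [->|z0] := eqVneq z 0; first by rewrite invr0 rnorm0 invr0.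
have nz0 : nm z != 0 by apply: contra_neq z0 => /rnorm0_eq0.
by apply: (mulfI nz0); rewrite -rnormM !divff// rnorm1.
Qed.

Lemma rnorm_sqr z : nm z ^+ 2 = complex.Re z ^+ 2 + complex.Im z ^+ 2.
Proof.
apply: (@complexI R).
by rewrite add_Re2_Im2 rmorphXn/=; congr (_ ^+ 2); rewrite -normE.
Qed.

Lemma rnorm_real (x : R) : nm x%:C = `|x|.
Proof.
apply/eqP; rewrite -(@eqrXn2 _ 2)// ?rnorm_ge0//.
by rewrite rnorm_sqr/= expr0n addr0 real_normK ?num_real.
Qed.

Lemma rnorm_imag (x : R) : nm (0 +i* x) = `|x|.
Proof.
apply/eqP; rewrite -(@eqrXn2 _ 2)// ?rnorm_ge0//.
by rewrite rnorm_sqr/= expr0n add0r real_normK ?num_real.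
Qed.

Lemma normRe_le z : `|complex.Re z| <= nm z.
Proof.
rewrite -(@ler_pXn2r _ 2)// ?nnegrE// ?rnorm_ge0// real_normK ?num_real// rnorm_sqr.
by rewrite lerDl sqr_ge0.
Qed.

Lemma normIm_le z : `|complex.Im z| <= nm z.
Proof.
rewrite -(@ler_pXn2r _ 2)// ?nnegrE// ?rnorm_ge0// real_normK ?num_real// rnorm_sqr.
by rewrite lerDr sqr_ge0.
Qed.

Lemma rnorm_leD z : nm z <= `|complex.Re z| + `|complex.Im z|.
Proof.
rewrite -(@ler_pXn2r _ 2)// ?nnegrE// ?rnorm_ge0// ?addr_ge0//.
rewrite rnorm_sqr -(real_normK (num_real (complex.Re z))).
rewrite -(real_normK (num_real (complex.Im z))).
have := normr_ge0 (complex.Re z); have := normr_ge0 (complex.Im z); nra.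
Qed.

(** The epsilon-delta form exposes the affine approximation that Goursat's argument subtracts. *)
Definition cdifferentiable (f : R[i] -> R[i]) w := exists A : R[i],
  forall e, 0 < e -> exists2 d : R, 0 < d & forall w', nm (w' - w) < d ->
    nm (f w' - f w - A * (w' - w)) <= e * nm (w' - w).

Lemma nbhs_rnorm (V : normedModType R[i]) (x : V) (A : set V) :
  nbhs x A <-> exists2 d : R, 0 < d & forall y, rnorm (y - x) < d -> A y.
Proof.
split=> [/nbhs_normP[e/= e0 eA]|[d d0 dA]].
  have e1 : e = (complex.Re e)%:C by rewrite RRe_real// gtr0_real.
  move: e0 eA; rewrite e1 ltcR => e0 eA; exists (complex.Re e) => // y xy.
  by apply: eA => /=; rewrite distrC normE ltcR.
apply/nbhs_normP; exists d%:C; rewrite /= ?ltcR// => y /= xy; apply: dA.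
by rewrite -ltcR -normE distrC.
Qed.

Lemma differentiable_cdiff (f : Cplx R -> Cplx R) (w : Cplx R) :
  differentiable f w -> cdifferentiable f w.
Proof.
move=> df; exists ('d f w 1) => e e0.
have e0' : 0 < e%:C :> R[i] by rewrite ltcR.
have [_ /eqaddoP/(_ _ e0')] := (diff_locallyP _ _).1 df.
move=> /nbhs_rnorm[d d0 dP]; exists d => // w' ww'.
have /= := dP (w' - w); rewrite subr0 => /(_ ww').
rewrite !fctE /= subrK /cst !normE -rmorphM lecR opprD addrA.
suff -> : 'd f w (w' - w) = 'd f w 1 * (w' - w) by [].
rewrite -[X in 'd f w X]mulr1 [RHS]mulrC.
exact: (linearZ_LR ('d f w) (w' - w) 1).
Qed.

End RealNorm.

(** * Riemann sums on the boundary of squares *)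

Section SquareSums.
Variable R : realType.
Implicit Types (k : R[i] -> R[i]) (c d w : R[i]) (x y l : R).
Local Notation nm z := (rnorm (z : Cplx R)).

(** A sum for the integral of [k] from [c] to [c + d]: [d] is the displacement, not the endpoint.
    Recursion on the two halves makes additivity hold by computation. *)
Fixpoint segsum (n : nat) k c d : R[i] :=
  if n is m.+1 then segsum m k c (d / 2) + segsum m k (c + d / 2) (d / 2)
  else d * k (c + d / 2).

(** The boundary is run counterclockwise; the top and left sides are parametrized in the increasing
    direction, whence their minus signs. *)
Definition squaresum n k x y l : R[i] :=
  segsum n k (x +i* y) (l +i* 0) + segsum n k ((x + l) +i* y) (0 +i* l)
  - segsum n k (x +i* (y + l)) (l +i* 0) - segsum n k (x +i* y) (0 +i* l).

Lemma half_complex (a b : R) : (a +i* b) / 2 = (a / 2) +i* (b / 2).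
Proof.
rewrite -[2 : R[i]](rmorph_nat (real_complex R) 2) -(fmorphV (real_complex R)).
by apply/eqP; rewrite eq_complex/= !mulr0 subr0 add0r !eqxx.
Qed.

Lemma segsumD n k1 k2 c d :
  segsum n (fun w => k1 w + k2 w) c d = segsum n k1 c d + segsum n k2 c d.
Proof.
elim: n c d => [|n IH] c d /=; first by rewrite mulrDr.
by rewrite !IH addrACA.
Qed.

Lemma segsumZ n (u : R[i]) k c d :
  segsum n (fun w => u * k w) c d = u * segsum n k c d.
Proof.
elim: n c d => [|n IH] c d /=; first by rewrite mulrCA.
by rewrite !IH mulrDr.
Qed.

Lemma segsum_affine n (u v : R[i]) c d :
  segsum n (fun w => u + v * w) c d = d * (u + v * (c + d / 2)).
Proof. by elim: n c d => [//|n IH] c d /=; rewrite !IH; field. Qed.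

Let midpointE c d : c + (2^-1)%:C * d = c + d / 2.
Proof. by rewrite fmorphV rmorph_nat mulrC. Qed.

Let left_half (t : R) c d : c + t%:C * (d / 2) = c + (t / 2)%:C * d.
Proof. by rewrite rmorphM fmorphV rmorph_nat; ring. Qed.

Let right_half (t : R) c d :
  c + d / 2 + t%:C * (d / 2) = c + ((1 + t) / 2)%:C * d.
Proof. by rewrite rmorphM fmorphV rmorph_nat rmorphD rmorph1; field. Qed.

Lemma eq_segsum n k1 k2 c d :
  (forall t : R, 0 <= t <= 1 -> k1 (c + t%:C * d) = k2 (c + t%:C * d)) ->
  segsum n k1 c d = segsum n k2 c d.
Proof.
elim: n c d => [|n IH] c d kE /=.
  have := kE 2^-1; rewrite midpointE.
  by move=> -> //; lra.
by congr (_ + _); apply: IH => t t01; rewrite ?(right_half, left_half);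
  apply: kE; lra.
Qed.

Lemma segsum_le n k c d B :
  (forall t : R, 0 <= t <= 1 -> nm (k (c + t%:C * d)) <= B) ->
  nm (segsum n k c d) <= nm d * B.
Proof.
have half : nm (2^-1 : R[i]) = 2^-1.
  by rewrite -(rmorph_nat (real_complex R) 2) -fmorphV rnorm_real ger0_norm.
elim: n c d => [|n IH] c d kB /=.
  rewrite rnormM ler_wpM2l ?rnorm_ge0//.
  have := kB 2^-1; rewrite midpointE.
  by apply; lra.
apply: le_trans (rnormD _ _) _.
have /IH : forall t : R, 0 <= t <= 1 -> nm (k (c + t%:C * (d / 2))) <= B.
  by move=> t t01; rewrite left_half; apply: kB; lra.
have /IH : forall t : R, 0 <= t <= 1 ->
    nm (k (c + d / 2 + t%:C * (d / 2))) <= B.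
  by move=> t t01; rewrite right_half; apply: kB; lra.
rewrite !rnormM half; lra.
Qed.

(** Serves to bound the sums of [1 / (w - a)] from below. Halving [d] halves [d * k], so each half
    of the segment accounts for [m / 2]. *)
Lemma segsum_Im_ge n k c d m :
  (forall t : R, 0 <= t <= 1 -> m <= complex.Im (d * k (c + t%:C * d))) ->
  m <= complex.Im (segsum n k c d).
Proof.
elim: n c d m => [|n IH] c d m km /=.
  have := km 2^-1; rewrite midpointE.
  by apply; lra.
have halfE (u : R[i]) : complex.Im (d / 2 * u) = complex.Im (d * u) / 2.
  by rewrite mulrAC; case: (d * u) => a b; rewrite half_complex.
have /IH h1 : forall t : R, 0 <= t <= 1 ->
    m / 2 <= complex.Im (d / 2 * k (c + t%:C * (d / 2))).
  move=> t t01; rewrite left_half halfE ler_pM2r ?invr_gt0//; apply: km; lra.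
have /IH h2 : forall t : R, 0 <= t <= 1 ->
    m / 2 <= complex.Im (d / 2 * k (c + d / 2 + t%:C * (d / 2))).
  move=> t t01; rewrite right_half halfE ler_pM2r ?invr_gt0//; apply: km; lra.
by rewrite raddfD/=; lra.
Qed.

Definition square x y l : set R[i] :=
  [set w | x <= complex.Re w <= x + l /\ y <= complex.Im w <= y + l].

Definition square_edges x y l : set R[i] :=
  [set w | square x y l w /\
    ([\/ complex.Re w = x, complex.Re w = x + l,
      complex.Im w = y | complex.Im w = y + l])].

Lemma edges_param x y l (t : R) : 0 <= l -> 0 <= t <= 1 ->
  [/\ square_edges x y l (x +i* y + t%:C * (l +i* 0)),
      square_edges x y l ((x + l) +i* y + t%:C * (0 +i* l)),
      square_edges x y l (x +i* (y + l) + t%:C * (l +i* 0)) &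
      square_edges x y l (x +i* y + t%:C * (0 +i* l))].
Proof.
move=> l0 t01; have tl : 0 <= t * l <= l by nra.
split; (split; first by split=> /=; lra).
- by constructor 3; rewrite /=; lra.
- by constructor 2; rewrite /=; lra.
- by constructor 4; rewrite /=; lra.
- by constructor 1; rewrite /=; lra.
Qed.

Lemma eq_squaresum n k1 k2 x y l : 0 <= l ->
  {in square_edges x y l, k1 =1 k2} ->
  squaresum n k1 x y l = squaresum n k2 x y l.
Proof.
move=> l0 kE; rewrite /squaresum; congr (_ + _ - _ - _);
  by apply: eq_segsum => t /(edges_param x y l0)[? ? ? ?]; apply/kE/mem_set.
Qed.

Lemma squaresum_le n k x y l B : 0 <= l ->
  (forall w, square_edges x y l w -> nm (k w) <= B) ->
  nm (squaresum n k x y l) <= 4 * l * B.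
Proof.
move=> l0 kB.
have nml : nm (l +i* 0) = l by rewrite (rnorm_real l) ger0_norm.
have nmil : nm (0 +i* l) = l by rewrite rnorm_imag ger0_norm.
have /(segsum_le n) h1 : forall t : R, 0 <= t <= 1 ->
    nm (k (x +i* y + t%:C * (l +i* 0))) <= B.
  by move=> t /(edges_param x y l0)[*]; apply: kB.
have /(segsum_le n) h2 : forall t : R, 0 <= t <= 1 ->
    nm (k ((x + l) +i* y + t%:C * (0 +i* l))) <= B.
  by move=> t /(edges_param x y l0)[*]; apply: kB.
have /(segsum_le n) h3 : forall t : R, 0 <= t <= 1 ->
    nm (k (x +i* (y + l) + t%:C * (l +i* 0))) <= B.
  by move=> t /(edges_param x y l0)[*]; apply: kB.
have /(segsum_le n) h4 : forall t : R, 0 <= t <= 1 ->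
    nm (k (x +i* y + t%:C * (0 +i* l))) <= B.
  by move=> t /(edges_param x y l0)[*]; apply: kB.
rewrite nml in h1 h3; rewrite nmil in h2 h4.
apply: le_trans (rnormB _ _) _; apply: le_trans (lerD (rnormB _ _) (lexx _)) _.
by have := rnormD (segsum n k (x +i* y) (l +i* 0) : Cplx R)
   (segsum n k ((x + l) +i* y) (0 +i* l)); lra.
Qed.

Lemma squaresumD n k1 k2 x y l :
  squaresum n (fun w => k1 w + k2 w) x y l =
  squaresum n k1 x y l + squaresum n k2 x y l.
Proof. by rewrite /squaresum !segsumD; ring. Qed.

Lemma squaresumZ n (u : R[i]) k x y l :
  squaresum n (fun w => u * k w) x y l = u * squaresum n k x y l.
Proof. by rewrite /squaresum !segsumZ; ring. Qed.

Lemma corners x y l :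
  ((x + l) +i* y = x +i* y + l +i* 0) * (x +i* (y + l) = x +i* y + 0 +i* l).
Proof. by split; apply/eqP; rewrite eq_complex/= addr0 !eqxx. Qed.

Lemma squaresum_affine n (u v : R[i]) x y l :
  squaresum n (fun w => u + v * w) x y l = 0.
Proof.
rewrite /squaresum !segsum_affine !corners.
set c := x +i* y; set e := l +i* 0; set d := 0 +i* l.
by move: c e d => c e d; field.
Qed.

(** Each inner side borders two quarters with opposite orientations and cancels; each outer side at
    level [n.+1] is by definition the sum of its halves at level [n]. *)
Lemma squaresumS n k x y l :
  squaresum n.+1 k x y l =
  squaresum n k x y (l / 2) + squaresum n k (x + l / 2) y (l / 2)
  + squaresum n k x (y + l / 2) (l / 2)
  + squaresum n k (x + l / 2) (y + l / 2) (l / 2).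
Proof.
have cD (a b a' b' : R) : (a +i* b) + (a' +i* b') = (a + a') +i* (b + b').
  by [].
rewrite /squaresum /= !half_complex mul0r !cD !addr0 -!addrA -!splitr.
set a1 := segsum n k (x +i* y) _; set a2 := segsum n k (_ +i* y) (_ +i* 0).
ring.
Qed.

End SquareSums.

(** * Goursat's theorem *)

Section Subdivision.
Variable R : realType.
Implicit Types (x y l : R) (s : R * R * R).

Let quarters s : seq (R * R * R) :=
  let: (x, y, l) := s in
  [:: (x, y, l / 2); (x + l / 2, y, l / 2); (x, y + l / 2, l / 2);
      (x + l / 2, y + l / 2, l / 2)].

(** If [P] failed, passing repeatedly to a failing quarter would give nested squares shrinking to a
    point, where the local hypothesis is contradicted. *)
Lemma square_induction (P : R -> R -> R -> Prop) x0 y0 l0 : 0 < l0 ->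
  (forall x y l, 0 < l -> P x y (l / 2) -> P (x + l / 2) y (l / 2) ->
     P x (y + l / 2) (l / 2) -> P (x + l / 2) (y + l / 2) (l / 2) ->
     P x y l) ->
  (forall a : R[i], square x0 y0 l0 a -> exists2 d : R, 0 < d &
     forall x y l, 0 < l -> l < d -> square x y l a -> P x y l) ->
  P x0 y0 l0.
Proof.
move=> l00 Pglue Plocal; apply: contrapT => nP0.
pose Q s := P s.1.1 s.1.2 s.2.
(* The premises stand after the existential so that [next] is total and can be iterated. *)
have /choice[next nextP] : forall s, exists t,
    0 < s.2 -> ~ Q s -> t \in quarters s /\ ~ Q t.
  move=> [[x y] l]; apply: contrapT => /forallNP h.
  have h' t : t \in quarters (x, y, l) -> 0 < l -> Q t.
    move=> tq l1; apply: contrapT => nQ; apply: (h t) => _ _; split=> //.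
  case: (ltP 0 l) => [l1|]; last first.
    by move=> l1; apply: (h (x, y, l)) => /=; rewrite ltNge l1.
  apply: (h (x, y, l)) => _ [].
  apply: Pglue => //; [apply: (h' (x, y, l / 2))|apply: (h' (x + l / 2, y, l / 2))|
    apply: (h' (x, y + l / 2, l / 2))|apply: (h' (x + l / 2, y + l / 2, l / 2))];
    by rewrite // !inE eqxx ?orbT.
pose sq n := iter n next (x0, y0, l0).
pose X n := (sq n).1.1; pose Y n := (sq n).1.2; pose L n := (sq n).2.
have sqP n : 0 < L n /\ ~ P (X n) (Y n) (L n).
  elim: n => [//|n [Ln nP]].
  have [] := nextP (sq n) Ln nP; rewrite /L /X /Y /= -/(sq n) => sqn nQ.
  split=> //; move: sqn Ln; rewrite /L; case: (sq n) => [[x y] l] /=.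
  by rewrite !inE => /or4P[] /eqP-> /=; lra.
have step n : [/\ X n <= X n.+1, X n.+1 + L n.+1 <= X n + L n,
    Y n <= Y n.+1, Y n.+1 + L n.+1 <= Y n + L n & L n.+1 = L n / 2].
  have [Ln nP] := sqP n; have [+ _] := nextP (sq n) Ln nP.
  move: Ln; rewrite /L /X /Y /= -/(sq n); case: (sq n) => [[x y] l] /= l1.
  by rewrite !inE => /or4P[] /eqP-> /=; split; lra.
have nested (Z : nat -> R) :
    (forall n, Z n <= Z n.+1 /\ Z n.+1 + L n.+1 <= Z n + L n) ->
    exists a, forall n, Z n <= a <= Z n + L n.
  move=> ZP; have Zle n m : Z n <= Z (n + m)%N /\ Z (n + m)%N + L (n + m)%N <= Z n + L n.
    elim: m => [|m [h1 h2]]; first by rewrite addn0.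
    by rewrite addnS; have [] := ZP (n + m)%N; lra.
  have Zub n m : Z m <= Z n + L n.
    have [h1 _] := Zle m n; have [_ h2] := Zle n m; have [Lp _] := sqP (m + n)%N.
    by rewrite addnC in h2; lra.
  exists (sup (range Z)) => n; apply/andP; split.
    apply: sup_upper_bound; last by exists n.
    by split; [exists (Z n), n|exists (Z n + L n) => _ [m _ <-]].
  by apply: ge_sup; [exists (Z n), n|move=> _ [m _ <-]].
have [a aP] := nested X (fun n => let: And5 h1 h2 _ _ _ := step n in conj h1 h2).
have [b bP] := nested Y (fun n => let: And5 _ _ h1 h2 _ := step n in conj h1 h2).
have [|d d0 dP] := Plocal (a +i* b).
  by split; [exact: (aP 0%N)|exact: (bP 0%N)].
(* The decay [l0 / 2 ^ n] is relaxed to [l0 / (n + 1)], which suffices for the Archimedean choice of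
   [n]. *)
have Ln n : L n <= l0 / n.+1%:R.
  elim: n => [|n IH]; first by rewrite divr1.
  have [_ _ _ _ ->] := step n.
  rewrite ler_pdivlMr// in IH; rewrite ler_pdivlMr//.
  rewrite -[n.+2%:R]natr1; have [Lp _] := sqP n.
  have : 1 <= n.+1%:R :> R by rewrite ler1n.
  nra.
have [n nd] : exists n, L n < d.
  exists (Num.bound (l0 / d)); apply: le_lt_trans (Ln _) _.
  rewrite ltr_pdivrMr// mulrC -ltr_pdivrMr//.
  apply: lt_trans (archi_boundP _) _; first by rewrite divr_ge0 ?ltW.
  by rewrite ltr_nat.
have [Lp] := sqP n; apply; apply: dP => //.
Qed.

End Subdivision.

Section Goursat.
Variable R : realType.
Implicit Types (k : R[i] -> R[i]) (w : R[i]) (x y l : R).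
Local Notation nm z := (rnorm (z : Cplx R)).

(** The signed square root of [t - a]. Its increments are additive and nonnegative on intervals, and
    at least the square root of the length on those containing [a]. *)
Let ssqrt (a t : R) : R := Num.sg (t - a) * Num.sqrt `|t - a|.

Let ssqrt_le (a s t : R) : s <= t -> ssqrt a s <= ssqrt a t.
Proof.
rewrite /ssqrt => st.
have [sa|sa] := leP a s.
  have -> : Num.sg (s - a) * Num.sqrt `|s - a| = Num.sqrt `|s - a|.
    have [->|s0] := eqVneq (s - a) 0; first by rewrite normr0 sqrtr0 mulr0.
    by rewrite gtr0_sg ?mul1r// lt_neqAle eq_sym s0 subr_ge0.
  have -> : Num.sg (t - a) * Num.sqrt `|t - a| = Num.sqrt `|t - a|.
    have [->|s0] := eqVneq (t - a) 0; first by rewrite normr0 sqrtr0 mulr0.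
    by rewrite gtr0_sg ?mul1r// lt_neqAle eq_sym s0 subr_ge0 (le_trans sa).
  by rewrite ler_sqrt// !ger0_norm; lra.
rewrite (ltr0_sg (x := s - a)) ?subr_lt0// mulN1r.
have [ta|ta] := ltP t a.
  rewrite (ltr0_sg (x := t - a)) ?subr_lt0// mulN1r lerN2.
  by rewrite ler_sqrt// !ltr0_norm; lra.
apply: (@le_trans _ _ 0); first by rewrite oppr_le0 sqrtr_ge0.
by rewrite mulr_ge0 ?sqrtr_ge0// sgr_ge0 subr_ge0.
Qed.

(** The increment is [sqrt (t - a) + sqrt (a - s)], whose square exceeds [t - s] by a nonnegative
    cross term. *)
Let ssqrt_ge (a s t : R) : s <= a <= t -> Num.sqrt (t - s) <= ssqrt a t - ssqrt a s.
Proof.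
move=> /andP[sa at_]; rewrite /ssqrt.
have -> : Num.sg (s - a) * Num.sqrt `|s - a| = - Num.sqrt (a - s).
  have [->|s0] := eqVneq s a; first by rewrite subrr normr0 sqrtr0 mulr0 oppr0.
  rewrite distrC ger0_norm ?subr_ge0// ltr0_sg ?mulN1r// subr_lt0.
  by rewrite lt_neqAle s0.
have -> : Num.sg (t - a) * Num.sqrt `|t - a| = Num.sqrt (t - a).
  have [->|s0] := eqVneq t a; first by rewrite subrr normr0 sqrtr0 mulr0.
  rewrite ger0_norm ?subr_ge0// gtr0_sg ?mul1r// subr_gt0.
  by rewrite lt_neqAle eq_sym s0.
rewrite opprK -(@ler_pXn2r _ 2)// ?nnegrE ?addr_ge0 ?sqrtr_ge0//.
rewrite sqrrD !sqr_sqrtr ?subr_ge0 ?(le_trans sa)//.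
have := sqrtr_ge0 (t - a); have := sqrtr_ge0 (a - s); nra.
Qed.

(* An additive function of the square: its first term controls the squares
   around the points where k is differentiable, and the second one, which is
   at least l for the squares containing a, those around a. *)
Let majorant (a : R[i]) x y l : R := l ^+ 2 +
  (ssqrt (complex.Re a) (x + l) - ssqrt (complex.Re a) x) *
  (ssqrt (complex.Im a) (y + l) - ssqrt (complex.Im a) y).

Let majorant_ge_sqr a x y l : 0 < l -> l ^+ 2 <= majorant a x y l.
Proof.
by move=> l0; rewrite lerDl mulr_ge0// subr_ge0 ssqrt_le// lerDl ltW.
Qed.

Let majorant_ge a x y l : 0 < l -> square x y l a -> l <= majorant a x y l.
Proof.
move=> l0 [/ssqrt_ge h1 /ssqrt_ge h2].
rewrite addrAC subrr add0r in h1; rewrite addrAC subrr add0r in h2.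
rewrite /majorant; have := sqr_sqrtr (ltW l0).
have := sqrtr_ge0 l; nra.
Qed.

Lemma square_diam x y l a w : square x y l a -> square x y l w ->
  nm (w - a) <= 2 * l.
Proof.
case: a w => [a1 a2] [w1 w2] [/= h1 h2] [/= h3 h4].
apply: le_trans (rnorm_leD _) _ => /=.
have : `|w1 - a1| <= l by rewrite ler_norml; lra.
have : `|w2 - a2| <= l by rewrite ler_norml; lra.
lra.
Qed.

(** At the exceptional point [a] only continuity is assumed, with a view to difference quotients
    filled in at their pole. The tolerance is shared among the squares in proportion to
    [majorant]. *)
Theorem Goursat k (a : R[i]) x0 y0 s : 0 < s ->
  (forall w, square x0 y0 s w -> w != a -> cdifferentiable k w) ->
  (forall e, 0 < e -> exists2 d : R, 0 < d &
     forall w, nm (w - a) < d -> nm (k w - k a) <= e) ->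
  forall e, 0 < e -> exists N, forall n, (N <= n)%N ->
    nm (squaresum n k x0 y0 s) <= e.
Proof.
move=> s0 kd ka e e0.
have m0 : 0 < majorant a x0 y0 s.
  by apply: lt_le_trans (majorant_ge_sqr _ _ _ s0); rewrite exprn_gt0.
pose e' := e / majorant a x0 y0 s; have e'0 : 0 < e' by rewrite divr_gt0.
have -> : e = e' * majorant a x0 y0 s by rewrite divfK ?gt_eqF.
apply: (@square_induction _ (fun x y l => exists N, forall n, (N <= n)%N ->
  nm (squaresum n k x y l) <= e' * majorant a x y l)) => //.
  move=> x y l l0 [N1 h1] [N2 h2] [N3 h3] [N4 h4].
  (* The successor pays for the subdivision, which lowers [n] by one on the quarters. *)
  exists (N1 + N2 + N3 + N4).+1 => -[//|n] Nn; rewrite squaresumS.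
  have {}h1 := h1 n ltac:(lia); have {}h2 := h2 n ltac:(lia).
  have {}h3 := h3 n ltac:(lia); have {}h4 := h4 n ltac:(lia).
  apply: le_trans (rnormD _ _) _; apply: le_trans (lerD (rnormD _ _) (lexx _)) _.
  apply: le_trans (lerD (lerD (rnormD _ _) (lexx _)) (lexx _)) _.
  apply: le_trans (lerD (lerD (lerD h1 h2) h3) h4) _.
  rewrite -!mulrDr ler_pM2l// /majorant -!addrA -!splitr le_eqVlt; apply/orP; left.
  by apply/eqP; field.
move=> b sb; have [->|ba] := eqVneq b a.
  (* Around [a] the constant [k a] is subtracted; the perimeter [4 * l] times [e' / 4] is [e' * l],
     which the second term of [majorant] absorbs. *)
  have [|d d0 dP] := ka (e' / 4); first by rewrite divr_gt0.
  exists (d / 2); first by rewrite divr_gt0.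
  move=> x y l l0 ld sa; exists 0%N => n _.
  have -> : squaresum n k x y l = squaresum n (fun w => k w + - k a) x y l.
    rewrite squaresumD -[X in _ = _ + X](_ : squaresum n
        (fun w => - k a + 0 * w) x y l = _).
      by rewrite squaresum_affine addr0.
    by apply: eq_squaresum => [|w _]; rewrite ?ltW// mul0r addr0.
  apply: le_trans (squaresum_le _ (ltW l0) (B := e' / 4) _) _.
    move=> w [sw _]; apply: dP.
    by apply: le_lt_trans (square_diam sa sw) _; lra.
  have := majorant_ge l0 sa; nra.
(* Elsewhere the affine approximation is subtracted. The remainder is at most [e' / 8 * (2 * l)] on
   the edges, so the sum is at most [e' * l ^+ 2], the first term of [majorant]. *)
have [A AP] := kd b sb ba.
have [|d d0 dP] := AP (e' / 8); first by rewrite divr_gt0.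
exists (d / 2); first by rewrite divr_gt0.
move=> x y l l0 ld {}sb; exists 0%N => n _.
have -> : squaresum n k x y l =
    squaresum n (fun w => k w + - (k b - A * b + A * w)) x y l.
  rewrite squaresumD -[X in _ = _ + X](_ : squaresum n
      (fun w => - (k b - A * b) + (- A) * w) x y l = _).
    by rewrite squaresum_affine addr0.
  by apply: eq_squaresum => [|w _]; rewrite ?ltW// mulNr -opprD.
apply: le_trans (squaresum_le _ (ltW l0) (B := e' / 8 * (2 * l)) _) _.
  move=> w [sw _]; have wb := square_diam sb sw.
  have -> : k w - (k b - A * b + A * w) = k w - k b - A * (w - b) by ring.
  apply: le_trans (dP _ _) _; first by apply: le_lt_trans wb _; lra.
  by rewrite ler_pM2l ?divr_gt0.
have := majorant_ge_sqr a x y l0; rewrite expr2; nra.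
Qed.

End Goursat.

(** * Cauchy's Lipschitz estimate *)

Section Lipschitz.
Variable R : realType.
Implicit Types (g : Cplx R -> Cplx R) (a b w : R[i]).
Local Notation nm z := (rnorm (z : Cplx R)).

(** With [A] the derivative of [g] at [b], this is the continuous extension across the pole, as
    Goursat's theorem asks at its exceptional point. *)
Definition diffquot g b (A : R[i]) w : R[i] :=
  if w == b then A else (g w - g b) / (w - b).

Lemma eq_cdifferentiable (f1 f2 : R[i] -> R[i]) w (d : R) : 0 < d ->
  (forall w', nm (w' - w) < d -> f1 w' = f2 w') ->
  cdifferentiable f1 w -> cdifferentiable f2 w.
Proof.
move=> d0 fE [A AP]; exists A => e /AP[d' d'0 dP].
exists (Num.min d d') => [|w']; first by rewrite lt_min d0.
rewrite lt_min => /andP[wd wd']; rewrite -!fE ?dP//.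
by rewrite subrr rnorm0.
Qed.

Lemma diffquot_cdifferentiable g b (A : R[i]) (w : Cplx R) :
  differentiable g w -> w != b ->
  cdifferentiable (diffquot g b A) w.
Proof.
move=> gw wb.
have wb0 : w - b != 0 by rewrite subr_eq0.
apply: (@eq_cdifferentiable (fun w => (g w - g b) * (w - b)^-1) _ w (nm (w - b))).
- by rewrite lt_neqAle rnorm_ge0 andbT eq_sym; apply: contra_neq wb0 => /rnorm0_eq0.
- move=> w' ww'; rewrite /diffquot; case: eqP => // w'b.
  by move: ww'; rewrite w'b rnorm_distC ltxx.
apply: (@differentiable_cdiff R (fun w => (g w - g b) * (w - b)^-1)).
apply: (@differentiableM R[i] (Cplx R) (fun w => g w - g b) (fun w => (w - b)^-1)).
  by apply: differentiableB => //; exact: differentiable_cst.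
apply: (@differentiableV R[i] (Cplx R) (fun w => w - b)) => //.
Qed.

Lemma diffquot_continuous g (b : Cplx R) : differentiable g b ->
  exists A, forall e, 0 < e -> exists2 d : R, 0 < d &
    forall w, nm (w - b) < d -> nm (diffquot g b A w - diffquot g b A b) <= e.
Proof.
move=> /differentiable_cdiff[A AP]; exists A => e e0.
have [d d0 dP] := AP e e0; exists d => // w wb.
rewrite /diffquot eqxx; case: eqP => [_|/eqP wb0].
  by rewrite subrr rnorm0 ltW.
have {}wb0 : w - b != 0 by rewrite subr_eq0.
have nwb : 0 < nm (w - b).
  by rewrite lt_neqAle rnorm_ge0 andbT eq_sym; apply: contra_neq wb0 => /rnorm0_eq0.
rewrite -(ler_pM2r nwb) -rnormM mulrBl divfK//; exact: dP.
Qed.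

Lemma Im_div (p q u v : R) :
  complex.Im ((p +i* q) * (u +i* v)^-1) = (q * u - p * v) / (u ^+ 2 + v ^+ 2).
Proof. by rewrite /=; ring. Qed.

(** A lower bound replaces the value 2 pi i of the contour integral. On each side the imaginary part
    to be summed is [2 * s ^+ 2 / (u ^+ 2 + s ^+ 2)] with [|u| <= s], so each side contributes at
    least 1. *)
Lemma squaresum_inv_ge n a (s : R) : 0 < s ->
  4 <= nm (squaresum n (fun w => (w - a)^-1)
             (complex.Re a - s) (complex.Im a - s) (2 * s)).
Proof.
case: a => a1 a2 s0 /=; apply: le_trans (normIm_le _); apply: le_trans (ler_norm _).
have bnd (u v : R) : u ^+ 2 <= s ^+ 2 -> v ^+ 2 = s ^+ 2 ->
    1 <= (2 * s * s) / (u ^+ 2 + v ^+ 2).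
  move=> us ->; have := sqr_ge0 u; rewrite ler_pdivlMr; nra.
have t2 (t : R) : 0 <= t <= 1 -> ((2 * t - 1) * s) ^+ 2 <= s ^+ 2.
  by move=> t01; rewrite exprMn ler_piMl ?sqr_ge0//; nra.
pose k w := (w - (a1 +i* a2))^-1.
have h1 : 1 <= complex.Im (segsum n k ((a1 - s) +i* (a2 - s)) ((2 * s) +i* 0)).
  apply: segsum_Im_ge => t t01; rewrite /k.
  rewrite [X in X^-1](_ : _ = ((2 * t - 1) * s) +i* (- s)); last first.
    by apply/eqP; rewrite eq_complex/=; apply/andP; split; apply/eqP; ring.
  rewrite Im_div; have := bnd _ (- s) (t2 t t01) (sqrrN s).
  by congr (_ <= _ / _); ring.
have h2 : 1 <= complex.Im (segsum n k ((a1 - s + 2 * s) +i* (a2 - s)) (0 +i* (2 * s))).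
  apply: segsum_Im_ge => t t01; rewrite /k.
  rewrite [X in X^-1](_ : _ = s +i* ((2 * t - 1) * s)); last first.
    by apply/eqP; rewrite eq_complex/=; apply/andP; split; apply/eqP; ring.
  rewrite Im_div; have := bnd _ s (t2 t t01) erefl.
  by congr (_ <= _ / _); ring.
(* The top and left sides enter with a minus sign, so the bound is proved for the opposite
   function. *)
have h3 : 1 <= complex.Im (segsum n (fun w => -1 * k w)
    ((a1 - s) +i* (a2 - s + 2 * s)) ((2 * s) +i* 0)).
  apply: segsum_Im_ge => t t01; rewrite /k mulN1r -invrN.
  rewrite [X in X^-1](_ : _ = (- ((2 * t - 1) * s)) +i* (- s)); last first.
    by apply/eqP; rewrite eq_complex/=; apply/andP; split; apply/eqP; ring.
  rewrite Im_div; have := bnd _ (- s) (t2 t t01) (sqrrN s).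
  by congr (_ <= _ / _); ring.
have h4 : 1 <= complex.Im (segsum n (fun w => -1 * k w)
    ((a1 - s) +i* (a2 - s)) (0 +i* (2 * s))).
  apply: segsum_Im_ge => t t01; rewrite /k mulN1r -invrN.
  rewrite [X in X^-1](_ : _ = s +i* (- ((2 * t - 1) * s))); last first.
    by apply/eqP; rewrite eq_complex/=; apply/andP; split; apply/eqP; ring.
  rewrite Im_div; have := bnd _ s (t2 t t01) erefl.
  by congr (_ <= _ / _); ring.
rewrite segsumZ mulN1r raddfN/= in h3; rewrite segsumZ mulN1r raddfN/= in h4.
rewrite /squaresum -/k !raddfB raddfD/=; lra.
Qed.

(** The difference quotients at [a] and [b] have negligible sums by Goursat. Comparing them leaves
    [g b - g a] times the sum of [1 / (w - a)], of modulus at least 4, against a remainder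
    controlled by [M]. *)
Lemma bounded_lipschitz g a b (s M : R) : 0 < s -> nm (b - a) < s ->
  (forall w : Cplx R, square (complex.Re a - s) (complex.Im a - s) (2 * s) w ->
     differentiable g w /\ nm (g w) <= M) ->
  nm (g b - g a) * (s - nm (b - a)) <= 4 * M * nm (b - a).
Proof.
move=> s0; set d := nm (b - a); set S := square _ _ _ => ds gS.
set x := complex.Re a - s; set y := complex.Im a - s.
have s20 : 0 < 2 * s by rewrite mulr_gt0.
have Sa : S a by split; rewrite /x /y; lra.
have Sb : S b.
  have := normRe_le (b - a); have := normIm_le (b - a); rewrite !raddfB/=.
  rewrite !ler_norml => h1 h2; rewrite /S /square /= -/d in h1 h2 *.
  by split; rewrite /x /y; lra.
have edge w : square_edges x y (2 * s) w -> s <= nm (w - a).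
  move=> [_ h]; have := normRe_le (w - a); have := normIm_le (w - a); rewrite !raddfB/=.
  rewrite !ler_norml => h1 h2; move: h; rewrite /x /y => h.
  by move: h => []; lra.
have edgeb w : square_edges x y (2 * s) w -> s - d <= nm (w - b).
  move=> /edge wa; have -> : w - b = (w - a) - (b - a) by ring.
  by have := rnormD ((w - a) - (b - a) : Cplx R) (b - a); rewrite subrK -/d; lra.
have ne w c : 0 < nm (w - c) -> w - c != 0.
  by move=> /gt_eqF/negbT; apply: contra => /eqP->; rewrite rnorm0.
have [A Acont] := diffquot_continuous (gS a Sa).1.
have [B Bcont] := diffquot_continuous (gS b Sb).1.
have GA e := Goursat s20
  (fun w Sw => diffquot_cdifferentiable A (gS w Sw).1) Acont (e := e).
have GB e := Goursat s20
  (fun w Sw => diffquot_cdifferentiable B (gS w Sw).1) Bcont (e := e).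
have M0 : 0 <= M by apply: le_trans (rnorm_ge0 _) (gS a Sa).2.
have d0 : 0 <= d by exact: rnorm_ge0.
suff : nm (g b - g a) <= 4 * M * d / (s - d) by rewrite ler_pdivlMr// subr_gt0.
apply/ler_addgt0Pr => e e0.
have [NA {}GA] := GA _ e0; have [NB {}GB] := GB _ e0.
pose n := (NA + NB)%N; have {}GA := GA n (leq_addr _ _); have {}GB := GB n (leq_addl _ _).
(* This identity moves the pole from [b] to [a], the centre of the square, where the lower bound for
   [1 / (w - a)] applies. *)
have key : squaresum n (diffquot g b B) x y (2 * s) +
    (g b - g a) * squaresum n (fun w => (w - a)^-1) x y (2 * s) =
    squaresum n (diffquot g a A) x y (2 * s) +
    squaresum n (fun w => (g w - g b) * ((w - b)^-1 - (w - a)^-1)) x y (2 * s).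
  rewrite -squaresumZ -!squaresumD; apply: eq_squaresum; first exact: ltW.
  move=> w /set_mem h; have wa := ne _ _ (lt_le_trans s0 (edge _ h)).
  have wb : w - b != 0 by apply: ne; have := edgeb _ h; lra.
  rewrite /diffquot -(subr_eq0 w b) -(subr_eq0 w a) (negbTE wa) (negbTE wb).
  by ring.
have err : nm (squaresum n (fun w => (g w - g b) * ((w - b)^-1 - (w - a)^-1)) x y (2 * s))
    <= 4 * (2 * s) * (2 * M * (d / (s * (s - d)))).
  apply: squaresum_le; first exact: ltW.
  move=> w h; have was := edge _ h; have wbs := edgeb _ h.
  have wa := ne _ _ (lt_le_trans s0 was).
  have wb : w - b != 0 by apply: ne; lra.
  rewrite rnormM ler_pM ?rnorm_ge0//.
    apply: le_trans (rnormB _ _) _.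
    by have [_] := gS w h.1; have [_] := gS b Sb; lra.
  have -> : (w - b)^-1 - (w - a)^-1 = (b - a) * ((w - a) * (w - b))^-1.
    by field; apply/andP.
  rewrite rnormM rnormV rnormM -/d ler_wpM2l// lef_pV2 ?posrE ?mulr_gt0 ?ler_pM//; lra.
have low := squaresum_inv_ge n a s0; rewrite -/x -/y in low.
have := congr1 (fun z => nm z) key => /=.
set K := (g b - g a) * _ => kE.
have : nm K <= nm (squaresum n (diffquot g a A) x y (2 * s)) +
   nm (squaresum n (fun w => (g w - g b) * ((w - b)^-1 - (w - a)^-1)) x y (2 * s))
   + nm (squaresum n (diffquot g b B) x y (2 * s)).
  have -> : K = squaresum n (diffquot g a A) x y (2 * s) +
    squaresum n (fun w => (g w - g b) * ((w - b)^-1 - (w - a)^-1)) x y (2 * s)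
     - squaresum n (diffquot g b B) x y (2 * s) by rewrite -key addrAC subrr add0r.
  by apply: le_trans (rnormB _ _) _; rewrite lerD2r rnormD.
rewrite /K rnormM => {kE}kE.
have : nm (g b - g a) * 4 <= nm (g b - g a) *
    nm (squaresum n (fun w => (w - a)^-1) x y (2 * s)).
  by rewrite ler_wpM2l// rnorm_ge0.
(* The target is the remainder bound divided by 4; the two Goursat errors then contribute at most
   [2 * e / 4]. *)
have -> : 4 * M * d / (s - d) = (4 * (2 * s) * (2 * M * (d / (s * (s - d))))) / 4.
  by field; apply/andP; split; rewrite ?gt_eqF ?subr_gt0.
lra.
Qed.

End Lipschitz.

(** * Peak functions on the disc *)

Section Peak.
Variable R : realType.
Implicit Types (z w : R[i]) (x y r p a e : R).
Local Notation nm z := (rnorm (z : Cplx R)).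

(** Young's inequality for [y * 1] with the conjugate exponents [a] and [a / (a - 1)]. *)
Lemma powR_Bernoulli a y : 1 < a -> 0 <= y -> 1 + a * (y - 1) <= y `^ a.
Proof.
move=> a1 y0; have a0 : 0 < a by lra.
have := @conjugate_powR R y 1 a (a / (a - 1)) y0 ler01 a0.
rewrite powR1 mulr1 invf_div => h.
have {}h : y <= y `^ a / a + 1 * ((a - 1) / a).
  by apply: h; [rewrite divr_gt0// subr_gt0|field; rewrite gt_eqF].
rewrite -(ler_pM2l a0) mulrDr mulrCA divff ?gt_eqF// in h.
rewrite mul1r mulrCA divff ?gt_eqF// in h; lra.
Qed.

Lemma vdisc_gt0 p z : nm z < 1 -> 0 < vdisc p z.
Proof. by move=> z1; rewrite powR_gt0// subr_gt0 exprn_ilt1 ?rnorm_ge0. Qed.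

Definition disc_ratio z w := (1 - nm w ^+ 2) / (1 - nm z ^+ 2).

(** Distance measured at the scale of the disc at [z], which makes the estimates uniform in [z]. *)
Definition disc_dist z w := nm (w - z) / (1 - nm z ^+ 2).

Section At.
Variable z : R[i].
Hypothesis z1 : nm z < 1.

Let D0 : 0 < 1 - nm z ^+ 2.
Proof. by rewrite subr_gt0 exprn_ilt1 ?rnorm_ge0. Qed.

Lemma disc_dist_ge0 w : 0 <= disc_dist z w.
Proof. by rewrite divr_ge0 ?rnorm_ge0 ?ltW. Qed.

Lemma vdisc_ratio p w : nm w < 1 ->
  vdisc p w = vdisc p z * disc_ratio z w `^ p.
Proof.
move=> w1; have Dw : 0 < 1 - nm w ^+ 2 by rewrite subr_gt0 exprn_ilt1 ?rnorm_ge0.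
rewrite /vdisc /disc_ratio -powRM ?ltW ?divr_gt0//.
by congr (_ `^ _); field; rewrite gt_eqF.
Qed.

Lemma rnorm_sqr_expand w :
  nm w ^+ 2 = nm z ^+ 2 + 2 * complex.Re (z^* * (w - z)) + nm (w - z) ^+ 2.
Proof. by rewrite !rnorm_sqr; case: z w => ? ? [? ?] /=; ring. Qed.

Lemma norm_Re_conj w : `|complex.Re (z^* * (w - z))| <= nm z * nm (w - z).
Proof.
apply: le_trans (normRe_le _) _; rewrite rnormM.
suff -> : nm z^* = nm z by [].
by rewrite /rnorm normcJ.
Qed.

Lemma disc_ratio_near w : disc_dist z w <= 1 ->
  `|disc_ratio z w - 1| <= 3 * disc_dist z w.
Proof.
have := norm_Re_conj w; have := disc_dist_ge0 w; set e := disc_dist z w.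
have eE : nm (w - z) = e * (1 - nm z ^+ 2) by rewrite divfK// gt_eqF.
have -> : disc_ratio z w - 1 =
   - (2 * complex.Re (z^* * (w - z)) + nm (w - z) ^+ 2) / (1 - nm z ^+ 2).
  by rewrite /disc_ratio rnorm_sqr_expand; field; rewrite gt_eqF.
have := D0; rewrite eE; set T := complex.Re _; set d := 1 - _.
have s0 := rnorm_ge0 (z : Cplx R).
have d1 : d <= 1 by rewrite gerBl exprn_ge0.
move=> d0 e0 Te e1; rewrite normrM normfV (gtr0_norm d0) ler_pdivrMr// normrN.
have ed0 : 0 <= e * d by rewrite mulr_ge0 ?(ltW d0).
have h1 : nm z * (e * d) <= e * d by rewrite ler_piMl ?(ltW z1).
have h2 : (e * d) ^+ 2 <= e * d by rewrite expr2 ler_piMl// mulr_ile1 ?(ltW d0).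
apply: le_trans (ler_normD _ _) _.
rewrite normrM (ger0_norm (x := 2))// (ger0_norm (sqr_ge0 _)); lra.
Qed.

Section Function.
Variables (p a : R) (q : nat).
Hypotheses (p1 : 1 <= p) (a1 : 1 < a).

(** The factor [a^-1] makes the modulus to the power [2 * a] agree with [disc_ratio z w] to first
    order at [z]; for [q = 2 * a * p] this is the criticality of [v * |peak|]. *)
Definition peak_base w : R[i] := 1 - (a * (1 - nm z ^+ 2))^-1%:C * (z^* * (w - z)).

Definition peak (w : Cplx R) : Cplx R := (vdisc p z)^-1%:C * (peak_base w ^+ q)^-1.

Lemma peak_center : peak z = (vdisc p z)^-1%:C.
Proof.
rewrite /peak /peak_base subrr mulr0 mulr0 subr0 expr1n invr1.
exact: mulr1.
Qed.

(** [Y] is Bernoulli's minorant [1 + a * (|peak_base w| ^+ 2 - 1)]. With [e = disc_dist z w], it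
    exceeds [disc_ratio z w] by [|z|^2 e^2 / a + (1 - |z|^2) e^2], the first-order terms cancelling,
    and this is at least [e^2 / a] since [a > 1]. *)
Lemma peak_base_ge w : nm w < 1 -> exists Y : R,
  [/\ disc_ratio z w + disc_dist z w ^+ 2 / a <= Y,
      Y <= (1 + disc_dist z w) ^+ 2 & Y <= (nm (peak_base w) ^+ 2) `^ a].
Proof.
move=> w1; have := norm_Re_conj w; have := disc_dist_ge0 w.
have a0 : 0 < a := lt_trans ltr01 a1.
set e := disc_dist z w.
have eE : nm (w - z) = e * (1 - nm z ^+ 2) by rewrite divfK// gt_eqF.
have XE : disc_ratio z w =
    1 - 2 * (complex.Re (z^* * (w - z)) / (1 - nm z ^+ 2)) - (1 - nm z ^+ 2) * e ^+ 2.
  by rewrite /disc_ratio rnorm_sqr_expand eE; field; rewrite gt_eqF.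
have NE : nm (peak_base w) ^+ 2 =
    1 - 2 / a * (complex.Re (z^* * (w - z)) / (1 - nm z ^+ 2)) + (nm z * e / a) ^+ 2.
  have -> : (nm z * e / a) ^+ 2 =
      (nm ((a * (1 - nm z ^+ 2))^-1%:C * (z^* * (w - z)))) ^+ 2.
    congr (_ ^+ 2); rewrite !rnormM rnorm_real.
    rewrite ger0_norm ?invr_ge0 ?mulr_ge0 ?(ltW D0) ?(ltW a0)//.
    have -> : nm z^* = nm z by rewrite /rnorm normcJ.
    by rewrite eE; field; rewrite !gt_eqF.
  rewrite /peak_base (rnorm_sqr (1 - _)) (rnorm_sqr (_ * _)).
  move: (z^* * (w - z)) => -[m1 m2] /=.
  by field; rewrite !gt_eqF.
set T := complex.Re _ / _ in XE NE; move=> e0.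
rewrite eE mulrCA mulrA -ler_pdivrMr// -[X in _ / X](gtr0_norm D0) -normf_div -/T mulrC.
move=> Te; exists (1 + a * (nm (peak_base w) ^+ 2 - 1)).
have s0 := rnorm_ge0 (z : Cplx R).
have -> : 1 + a * (nm (peak_base w) ^+ 2 - 1) = 1 - 2 * T + nm z ^+ 2 * (e ^+ 2 / a).
  by rewrite NE; field; rewrite gt_eqF.
have ea : e ^+ 2 / a <= e ^+ 2 by rewrite ler_pdivrMr// ler_peMr ?sqr_ge0// ltW.
have ea0 : 0 <= e ^+ 2 / a by rewrite divr_ge0 ?sqr_ge0 ?(ltW a0).
have ssq0 := sqr_ge0 (nm z).
split.
- rewrite XE; move: ea ea0 ssq0 (D0); set E := e ^+ 2 / a; set S := nm z ^+ 2; nra.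
- have Te' : `|T| <= e by apply: le_trans Te _; rewrite ler_piMl// ltW.
  have := ler_norm (- T); rewrite normrN; move: ea ea0 ssq0 (D0).
  set E := e ^+ 2 / a; set S := nm z ^+ 2; nra.
- have := powR_Bernoulli a1 (sqr_ge0 (nm (peak_base w))).
  rewrite NE; congr (_ <= _); field; rewrite gt_eqF//.
Qed.

Lemma disc_ratio_gt0 w : nm w < 1 -> 0 < disc_ratio z w.
Proof. by move=> w1; rewrite divr_gt0// subr_gt0 exprn_ilt1 ?rnorm_ge0. Qed.

(** A zero would force [Y <= 0], whereas [Y] dominates the positive [disc_ratio z w]. *)
Lemma peak_base_neq0 w : nm w < 1 -> peak_base w != 0.
Proof.
have a0 : 0 < a := lt_trans ltr01 a1.
move=> w1; have [Y [XY _]] := peak_base_ge w1; apply: contraTneq => ->.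
rewrite rnorm0 expr0n/= powR0 ?gt_eqF//.
rewrite -ltNge; apply: lt_le_trans XY; apply: ltr_wpDr (disc_ratio_gt0 w1).
by rewrite divr_ge0 ?sqr_ge0// ltW.
Qed.

Lemma peak_differentiable (w : Cplx R) : nm w < 1 -> differentiable peak w.
Proof.
move=> w1.
apply: (@differentiableZ R[i] (Cplx R) (Cplx R) (fun w => (peak_base w ^+ q)^-1)).
apply: (@differentiableV R[i] (Cplx R) (fun w => peak_base w ^+ q)); last first.
  by rewrite expf_neq0// peak_base_neq0.
have dbase : differentiable (peak_base : Cplx R -> Cplx R) w.
  apply: differentiableB; first exact: differentiable_cst.
  apply: (@differentiableZ R[i] (Cplx R) (Cplx R) (fun w => z^* * (w - z))).
  apply: (@differentiableZ R[i] (Cplx R) (Cplx R) (fun w => w - z)).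
  by apply: differentiableB.
case: q => [|n]; first by rewrite (_ : (fun _ => _) = cst 1)//; exact: differentiable_cst.
have := @differentiableX R[i] (Cplx R) peak_base n w dbase.
by rewrite exprfctE.
Qed.

(** With [X = disc_ratio z w], the left side is at most [(X / Y) ^ p], hence at most [X / Y] because
    [p >= 1]. The bounds on [Y] give the gap [e^2 / (a (1 + e)^2)], increasing in [e]. The case
    [r = 0] gives the bound 1 on the disc. *)
Lemma peak_le w r : q%:R = 2 * (a * p) -> nm w < 1 -> 0 <= r <= disc_dist z w ->
  vdisc p w * nm (peak w) <= 1 - r ^+ 2 / (a * (1 + r) ^+ 2).
Proof.
move=> qE w1 /andP[r0 re]; have a0 : 0 < a := lt_trans ltr01 a1.
have e0 := disc_dist_ge0 w; set e := disc_dist z w in re e0.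
have X0 := disc_ratio_gt0 w1.
have [Y [XY Ye YW]] := peak_base_ge w1.
rewrite -/e in XY Ye; set X := disc_ratio z w in X0 XY.
have e2a : 0 <= e ^+ 2 / a by rewrite divr_ge0 ?sqr_ge0 ?ltW.
have Y0 : 0 < Y by lra.
have W0 : 0 < nm (peak_base w).
  rewrite lt_neqAle rnorm_ge0 andbT eq_sym.
  by apply: contra_neq (peak_base_neq0 w1) => /rnorm0_eq0.
have YWq : Y `^ p <= nm (peak_base w) ^+ q.
  have -> : nm (peak_base w) ^+ q = ((nm (peak_base w) ^+ 2) `^ a) `^ p.
    rewrite -powRrM -(powR_mulrn 2) ?(ltW W0)// -powRrM -powR_mulrn ?(ltW W0)//.
    by rewrite qE mulrA.
  clear qE.
  by apply: ge0_ler_powR; rewrite ?nnegrE ?powR_ge0 ?(ltW Y0) ?(le_trans ler01 p1).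
have XYp : vdisc p w * nm (peak w) <= (X / Y) `^ p.
  rewrite vdisc_ratio// /peak rnormM rnorm_real rnormV rnormX.
  have vz := vdisc_gt0 p z1.
  rewrite gtr0_norm ?invr_gt0// mulrACA divff ?gt_eqF// mul1r.
  rewrite [(X / Y) `^ p]powRM ?invr_ge0 ?(ltW X0) ?(ltW Y0)//.
  rewrite ler_wpM2l ?powR_ge0//.
  rewrite -[Y^-1]powR_inv1 ?(ltW Y0)// -powRrM mulN1r powRN.
  by rewrite lef_pV2 ?posrE ?powR_gt0 ?exprn_gt0.
apply: le_trans XYp _.
have XY1 : 0 < X / Y <= 1.
  by rewrite divr_gt0// ler_pdivrMr// mul1r; lra.
apply: le_trans (ge1r_powR XY1 p1) _.
have : X / Y <= 1 - (e ^+ 2 / a) / Y.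
  by rewrite -[1 in leRHS](divff (lt0r_neq0 Y0)) -mulrBl ler_pM2r ?invr_gt0//; lra.
move=> h; apply: le_trans h _; rewrite lerD2l lerN2.
have e1 : 0 < (1 + e) ^+ 2 by rewrite exprn_gt0; lra.
have r1 : 0 < (1 + r) ^+ 2 by rewrite exprn_gt0; lra.
apply: (@le_trans _ _ (e ^+ 2 / a / (1 + e) ^+ 2)); last first.
  by rewrite ler_wpM2l// lef_pV2.
have -> : r ^+ 2 / (a * (1 + r) ^+ 2) = r ^+ 2 / (1 + r) ^+ 2 / a.
  by field; rewrite !gt_eqF// ltr_wpDr.
rewrite [leRHS]mulrAC ler_pM2r ?invr_gt0// -!expr_div_n.
have e11 : 0 < 1 + e by lra.
have r11 : 0 < 1 + r by lra.
have rr0 : 0 <= r / (1 + r) := divr_ge0 r0 (ltW r11).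
have re1 : r / (1 + r) <= e / (1 + e).
  by rewrite ler_pdivlMr// mulrAC ler_pdivrMr//; lra.
by apply: lerXn2r; rewrite ?nnegrE// (le_trans rr0).
Qed.

End Function.
End At.
End Peak.

(** * Compactness *)

Section Topology.
Variable R : realType.
Local Notation nm z := (rnorm (z : Cplx R)).

Lemma Complex_continuous :
  continuous (fun st : R * R => (st.1 +i* st.2) : Cplx R).
Proof.
move=> [a b] A /nbhs_rnorm[d d0 dA].
have d20 : 0 < d / 2 by rewrite divr_gt0.
exists (ball a (d / 2), ball b (d / 2)); first by split; exact: nbhsx_ballx.
move=> [s t] [/= sa tb]; apply: dA => /=.
apply: le_lt_trans (rnorm_leD _) _ => /=.
by rewrite [d]splitr ltrD// distrC.
Qed.

Lemma compact_square (x y l : R) : compact (square x y l : set (Cplx R)).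
Proof.
have -> : square x y l = (fun st : R * R => (st.1 +i* st.2) : Cplx R) @`
    ([set` `[x, x + l]] `*` [set` `[y, y + l]]).
  apply/seteqP; split=> [[a b] [/= h1 h2]|_ [[a b] [/= h1 h2] <-]].
    by exists (a, b) => //; split; rewrite /= in_itv.
  by rewrite !in_itv /= in h1 h2.
apply: continuous_compact; last by apply: compact_setX; exact: segment_compact.
by apply: continuous_subspaceT; exact: Complex_continuous.
Qed.

Lemma rnorm_continuous (V : normedModType R[i]) : continuous (@rnorm R V).
Proof.
move=> x A /nbhs_ballP[d /= d0 dA]; apply/nbhs_rnorm; exists d => // y xy.
apply: dA; rewrite /ball/=; apply: le_lt_trans xy.
have h1 := rnormD (x - y) y; have h2 := rnormD (y - x) x.
rewrite !subrK in h1 h2; rewrite rnorm_distC in h1.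
by rewrite ler_norml; lra.
Qed.

Lemma vdisc_continuous (p : R) (z : Cplx R) : nm z < 1 ->
  {for z, continuous (vdisc p : Cplx R -> R)}.
Proof.
move=> z1; rewrite /vdisc.
rewrite (_ : (fun _ => _) =
  (fun x => powR x p) \o (fun z : Cplx R => 1 - rnorm z ^+ 2))//.
apply: continuous_comp.
  have c2 : {for z, continuous (fun z : Cplx R => rnorm z ^+ 2)}.
    apply: (@continuous_comp _ _ _ (@rnorm R (Cplx R)) (fun x => x ^+ 2)).
      exact: rnorm_continuous.
    exact: exprn_continuous.
  by apply: (@continuousB _ R _ (cst 1)) c2; exact: cst_continuous.
apply: differentiable_continuous; apply/derivable1_diffP.
apply: derivable_powR; rewrite in_itv/= andbT.
by rewrite subr_gt0 exprn_ilt1 ?rnorm_ge0.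
Qed.

End Topology.

(** * Weighted supremum norms *)

Section WeightedNorm.
Variables (R : realType) (E F : normedModType R[i]) (U : set E) (v : E -> R).
Implicit Types f : E -> F.

Lemma wnorm_le f (b : R) :
  (forall z, U z -> v z * rnorm (f z) <= b) -> (wnorm U v f <= b%:E)%E.
Proof. by move=> h; apply: ge_ereal_sup => _ [z Uz <-]; rewrite lee_fin h. Qed.

Lemma le_wnorm f (b : R) z :
  (wnorm U v f <= b%:E)%E -> U z -> v z * rnorm (f z) <= b.
Proof.
move=> h Uz; rewrite -lee_fin; apply: le_trans h.
by apply: ereal_sup_ubound; exists z.
Qed.

End WeightedNorm.

Section Perturbation.
Variables (R : realType) (F : normedModType R[i]) (U : set (Cplx R)) (v : Cplx R -> R).

(* Relative compactness: v f ranges in a compact set and v h in a bounded set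
   of scalars. *)
Lemma HinfK_perturb (f : Cplx R -> F) (h : Cplx R -> Cplx R) (c m : R) (u : F) (b : R) :
  HinfK U v f -> (forall z, U z -> differentiable h z) ->
  (forall z, U z -> 0 <= v z) ->
  (forall z, U z -> v z * rnorm (h z) <= 1) ->
  (forall z, U z -> v z * rnorm (m%:C *: (f z + (c%:C * h z) *: u)) <= b) ->
  HinfK U v (fun z => m%:C *: (f z + (c%:C * h z) *: u)).
Proof.
move=> [[fd fn] fc] hd v0 hb bb; split; first split.
- move=> z Uz; apply: differentiableZ; apply: differentiableD; first exact: fd.
  apply: (@differentiableZl R[i] (Cplx R) F (fun z => c%:C * h z)).
  by apply: (@differentiableZ R[i] (Cplx R) (Cplx R) h); exact: hd.
- by apply: le_lt_trans (wnorm_le bb) _; rewrite ltry.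
(* [Phi] sends the pair [(v f, v h)] to [v] times the perturbed mapping; the square used below
   contains the closed unit disc, where [v h] takes its values. *)
- pose Phi (xc : F * Cplx R) := m%:C *: (xc.1 + (c%:C * xc.2 : Cplx R) *: u).
  have Phic : continuous Phi.
    move=> xc; apply: cvgZl_tmp; apply: cvgD; first exact: cvg_fst.
    apply: cvgZr_tmp; apply: (@cvgZl_tmp _ (Cplx R)); exact: cvg_snd.
  set K := closure [set (v z)%:C *: f z | z in U].
  have cK : compact K by rewrite -precompactE.
  have cI : compact (Phi @` (K `*` (square (-1) (-1) 2 : set (Cplx R)))).
    apply: continuous_compact; first exact: continuous_subspaceT.
    by apply: compact_setX => //; exact: compact_square.
  apply: (@precompact_subset _ _ (Phi @` (K `*` (square (-1) (-1) 2 : set (Cplx R))))).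
    move=> _ [z Uz <-]; exists ((v z)%:C *: f z, (v z)%:C * h z); last first.
      rewrite /Phi/= [RHS]scalerA [X in _ = X *: _]mulrC -[RHS]scalerA.
      congr (_ *: _); rewrite scalerDr scalerA; congr (_ + _ *: _).
      by rewrite mulrCA.
    split=> /=; first by apply: subset_closure; exists z.
    have vh : rnorm ((v z)%:C * h z : Cplx R) <= 1.
      by rewrite rnormM rnorm_real ger0_norm ?v0 ?hb.
    have := normRe_le ((v z)%:C * h z); have := normIm_le ((v z)%:C * h z).
    by rewrite !ler_norml /square /=; lra.
  by rewrite precompact_closed//; apply: compact_closed => //; exact: norm_hausdorff.
Qed.

End Perturbation.

(** * Perturbation and conclusion *)

Section DualEstimate.
Variable R : realType.
Local Notation nm z := (rnorm (z : Cplx R)).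

(** Since [1 - |z|^2 <= 2 (1 - |z|)], the point [w] is within [(1 - |z|) / 2] of [z]. *)
Lemma disc_dist_lt1 (z w : R[i]) : nm z < 1 -> disc_dist z w <= 1 / 4 -> nm w < 1.
Proof.
move=> z1 e4; have D0 : 0 < 1 - nm z ^+ 2 by rewrite subr_gt0 exprn_ilt1 ?rnorm_ge0.
have := rnormD (w - z : Cplx R) z; rewrite subrK.
rewrite ler_pdivrMr// in e4.
have := rnorm_ge0 (z : Cplx R); move: e4 z1; set x := nm z; set y := nm w; nra.
Qed.

(** The difference splits into [v(z) (g z - g z0)], bounded by the Lipschitz estimate, and
    [(v(z0) - v(z)) g z0], bounded through [disc_ratio]. *)
Lemma weighted_delta_close (p : R) (z z0 : R[i]) (g : Cplx R -> Cplx R) : 1 <= p ->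
  nm z < 1 -> disc_dist z z0 <= 1 / 16 ->
  (forall w : Cplx R, nm w < 1 -> differentiable g w /\ vdisc p w * nm (g w) <= 1) ->
  nm ((vdisc p z)%:C * g z - (vdisc p z0)%:C * g z0) <=
  (64 * disc_dist z z0 + `|disc_ratio z z0 `^ p - 1|) / (1 / 4) `^ p.
Proof.
move=> p1 z1 e16 gP; have p0 : 0 <= p by lra.
have D0 : 0 < 1 - nm z ^+ 2 by rewrite subr_gt0 exprn_ilt1 ?rnorm_ge0.
have e0 := disc_dist_ge0 z1 z0.
have vz := vdisc_gt0 p z1.
(* If [disc_dist z w <= 1 / 4], then [disc_ratio z w >= 1 - 3 / 4], so [v(w) >= C0 * v(z)]. *)
set C0 := (1 / 4) `^ p; have C00 : 0 < C0 by rewrite powR_gt0; lra.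
have near w : disc_dist z w <= 1 / 4 ->
    nm w < 1 /\ vdisc p z * nm (g w) <= C0^-1.
  move=> e4; have w1 := disc_dist_lt1 z1 e4; split=> //.
  have [_] := gP w w1; rewrite (vdisc_ratio z1)// mulrAC => h.
  have X4 : 1 / 4 <= disc_ratio z w.
    have := disc_ratio_near z1 (le_trans e4 _); rewrite ler_norml => /(_ ltac:(lra)).
    by lra.
  have XC : C0 <= disc_ratio z w `^ p.
    by apply: ge0_ler_powR => //; rewrite nnegrE; lra.
  rewrite -(ler_pM2r C00) mulVf ?gt_eqF//; apply: le_trans h.
  by rewrite ler_wpM2l// mulr_ge0 ?rnorm_ge0 ?ltW.
set e := disc_dist z z0 in e16 e0 *.
have eE : nm (z0 - z) = e * (1 - nm z ^+ 2) by rewrite divfK// gt_eqF.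
set d := 1 - nm z ^+ 2 in D0 eE.
have lip : vdisc p z * nm (g z0 - g z) <= 64 * e / C0.
  (* The square of half-side [d / 8] stays within [d / 4] of [z]. As [1 / 8 - e >= 1 / 16], the
     factor 4 of the Lipschitz estimate becomes 64. *)
  have : nm (g z0 - g z) * (d / 8 - nm (z0 - z)) <=
      4 * (C0^-1 / vdisc p z) * nm (z0 - z).
    apply: bounded_lipschitz; rewrite ?eE ?divr_gt0//; first by nra.
    move=> w sw; have [] := near w.
      rewrite ler_pdivrMr// -/d.
      have : nm (w - z) <= `|complex.Re (w - z)| + `|complex.Im (w - z)| := rnorm_leD _.
      move: sw => [s1 s2]; rewrite !raddfB/=.
      have : `|complex.Re w - complex.Re z| <= d / 8 by rewrite ler_norml; lra.
      have : `|complex.Im w - complex.Im z| <= d / 8 by rewrite ler_norml; lra.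
      lra.
    by move=> /gP[? _] h; split=> //; rewrite ler_pdivlMr// mulrC.
  rewrite eE.
  have -> : 4 * (C0^-1 / vdisc p z) * (e * d) = 4 * C0^-1 * e / vdisc p z * d by ring.
  have -> : d / 8 - e * d = (1 / 8 - e) * d by ring.
  rewrite [leLHS]mulrA ler_pM2r// ler_pdivlMr//.
  rewrite [X in _ <= X](_ : _ = 4 * e / C0); last by ring.
  have : 0 <= e / C0 by rewrite divr_ge0 ?(ltW C00).
  have -> : 64 * e / C0 = 64 * (e / C0) by ring.
  have -> : 4 * e / C0 = 4 * (e / C0) by ring.
  have := rnorm_ge0 (g z0 - g z); move: (rnorm _) (e / C0) => N E N0 E0.
  have : 0 <= vdisc p z * N by rewrite mulr_ge0 ?(ltW vz).
  by move: (vdisc p z) => V; nra.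
have [z01 hz0] : nm z0 < 1 /\ vdisc p z * nm (g z0) <= C0^-1.
  by apply: near; rewrite -/e; lra.
have -> : (vdisc p z)%:C * g z - (vdisc p z0)%:C * g z0 =
    (vdisc p z)%:C * (g z - g z0) - (vdisc p z0 - vdisc p z)%:C * g z0.
  by rewrite rmorphB /=; ring.
apply: le_trans (rnormB _ _) _; rewrite mulrDl; apply: lerD.
  by rewrite rnormM rnorm_real gtr0_norm// rnorm_distC.
rewrite rnormM rnorm_real (vdisc_ratio z1 p z01) -[X in _ - X]mulr1 -mulrBr normrM.
by rewrite gtr0_norm// mulrAC mulrC ler_wpM2l.
Qed.

Lemma powR_near1 (p e : R) : 0 < e -> exists2 d : R, 0 < d &
  forall x, `|x - 1| < d -> `|x `^ p - 1| < e.
Proof.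
move=> e0; have : {for (1 : R), continuous (fun x => x `^ p)}.
  apply: differentiable_continuous; apply/derivable1_diffP.
  by apply: derivable_powR; rewrite in_itv/= andbT.
move=> /(_ [set y | `|y - 1| < e]) h.
have /h : nbhs (1 `^ p) [set y : R | `|y - 1| < e].
  rewrite powR1; apply/nbhs_ballP; exists e => // y.
  by rewrite /ball/= distrC.
move=> /nbhs_ballP[d /= d0 dP]; exists d => // x x1.
by apply: (dP x); rewrite /ball/= distrC.
Qed.

End DualEstimate.

(** * Attainment of the perturbed norm near [z] *)

Section Attain.
Variables (R : realType) (F : normedModType R[i]).
Local Notation nm z := (rnorm (z : Cplx R)).

(** The direction [u] of [f z] makes the perturbation add exactly [c] to [v |f|] at [z]. Off a small
    square the gap of the peak keeps [v |f1|] below that value, so the maximum over the compact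
    square is global. *)
Lemma perturb_attains (p a r c : R) (q : nat) (f : Cplx R -> F) (z : Cplx R) :
  1 <= p -> 1 < a -> q%:R = 2 * (a * p) -> 0 < r -> r <= 1 / 8 -> 0 < c ->
  (forall w : Cplx R, nm w < 1 -> differentiable f w /\ vdisc p w * rnorm (f w) <= 1) ->
  nm z < 1 -> 0 < rnorm (f z) ->
  1 - c * (r ^+ 2 / (a * (1 + r) ^+ 2)) < vdisc p z * rnorm (f z) ->
  let u := (rnorm (f z))^-1%:C *: f z in
  let f1 := fun w => f w + (c%:C * peak z p a q w) *: u in
  exists z0 : Cplx R, [/\ nm z0 < 1, disc_dist z z0 <= 2 * r,
    vdisc p z * rnorm (f z) + c <= vdisc p z0 * rnorm (f1 z0) &
    forall w, nm w < 1 -> vdisc p w * rnorm (f1 w) <= vdisc p z0 * rnorm (f1 z0)].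
Proof.
move=> p1 a1 qE r0 r8 c0 fP z1 fz0 fzc u f1.
have D0 : 0 < 1 - nm z ^+ 2 by rewrite subr_gt0 exprn_ilt1 ?rnorm_ge0.
set d := 1 - nm z ^+ 2 in D0.
have rd0 : 0 < r * d by rewrite mulr_gt0.
pose S : set (Cplx R) :=
  square (complex.Re z - r * d) (complex.Im z - r * d) (2 * (r * d)).
have Sz : S z by rewrite /S /square /=; split; lra.
have Sdist w : S w -> disc_dist z w <= 2 * r.
  move=> [s1 s2]; rewrite ler_pdivrMr// -/d; apply: le_trans (rnorm_leD _) _.
  rewrite !raddfB/=.
  have : `|complex.Re w - complex.Re z| <= r * d by rewrite ler_norml; lra.
  have : `|complex.Im w - complex.Im z| <= r * d by rewrite ler_norml; lra.
  lra.
have Sdisc w : S w -> nm w < 1.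
  by move=> /Sdist h; apply: (disc_dist_lt1 z1); lra.
have notS w : ~ S w -> r <= disc_dist z w.
  move=> nS; rewrite ler_pdivlMr// -/d leNgt; apply/negP => h; apply: nS.
  have := le_lt_trans (normRe_le (w - z)) h; have := le_lt_trans (normIm_le (w - z)) h.
  by rewrite !raddfB/= !ltr_norml /S /square /=; lra.
have u1 : rnorm u = 1.
  by rewrite rnormZ rnorm_real gtr0_norm ?invr_gt0// mulVf ?gt_eqF.
have f1z : vdisc p z * rnorm (f1 z) = vdisc p z * rnorm (f z) + c.
  have vz := vdisc_gt0 p z1.
  rewrite /f1 peak_center scalerA -[X in X + _]scale1r -scalerDl.
  rewrite -!rmorphM -[1](rmorph1 (real_complex R)) -rmorphD rnormZ rnorm_real.
  rewrite ger0_norm; first by field; rewrite !gt_eqF.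
  by rewrite addr_ge0// !mulr_ge0// ?invr_ge0 ltW.
have f1c (w : Cplx R) : nm w < 1 -> {for w, continuous f1}.
  move=> w1; apply: differentiable_continuous.
  apply: differentiableD; first by have [] := fP w w1.
  apply: (@differentiableZl R[i] (Cplx R) F (fun z' => c%:C * peak z p a q z')).
  by apply: (@differentiableZ R[i] (Cplx R) (Cplx R)); exact: peak_differentiable.
have [z0 Sz0 z0max] : exists2 z0, z0 \in S & forall w, w \in S ->
    vdisc p w * rnorm (f1 w) <= vdisc p z0 * rnorm (f1 z0).
  apply: (@compact_EVT_max (Cplx R) R (fun w => vdisc p w * rnorm (f1 w)) S).
  - by exists z.
  - exact: compact_square.
  - apply: continuous_in_subspaceT => w /set_mem /Sdisc w1.
    have vw : vdisc p x @[x --> w] --> vdisc p w by exact: vdisc_continuous.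
    have fw : rnorm (f1 x) @[x --> w] --> rnorm (f1 w).
      apply: continuous_comp; first exact: f1c.
      exact: rnorm_continuous.
    exact: (cvgM vw fw).
move/set_mem in Sz0.
have zz0 : vdisc p z * rnorm (f z) + c <= vdisc p z0 * rnorm (f1 z0).
  by rewrite -f1z; apply: z0max; exact/mem_set.
exists z0; split=> //; [exact: Sdisc|exact: Sdist|].
move=> w w1; have [Sw|/notS rw] := pselect (S w); first exact/z0max/mem_set.
apply: le_trans zz0.
have := @peak_le R z z1 p a q p1 a1 w r qE w1; rewrite (ltW r0) rw => /(_ isT) pk.
have [_ fw] := fP w w1.
have : rnorm (f1 w) <= rnorm (f w) + c * nm (peak z p a q w).
  apply: le_trans (rnormD _ _) _.
  by rewrite rnormZ u1 mulr1 rnormM rnorm_real (gtr0_norm c0).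
move=> f1w; apply: le_trans (ler_wpM2l (ltW (vdisc_gt0 p w1)) f1w) _.
rewrite mulrDr mulrCA; move: fzc (ler_wpM2l (ltW c0) pk) fw.
by rewrite mulrBr mulr1; lra.
Qed.

End Attain.

Theorem proposition3p3 (R : realType) (p : R) (hp : 1 <= p)
    (F : completeNormedModType R[i]) :
  WHinf_BPB (unit_disc R) (vdisc p)
    (HinfK (unit_disc R) (vdisc p) : set (Cplx R -> F)).
Proof.
move=> eps /andP[eps0 eps1].
have p0 : 0 < p by lra.
(* [Num.bound] yields a natural number above [2 * p], whence [1 < a]. *)
pose q := (Num.bound (2 * p)); pose a := q%:R / (2 * p).
have a1 : 1 < a.
  by rewrite ltr_pdivlMr ?mulr_gt0// mul1r archi_boundP// mulr_ge0// ltW.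
have qE : q%:R = 2 * (a * p) by rewrite mulrA (mulrC 2) -mulrA divfK// gt_eqF// mulr_gt0.
set C0 : R := (1 / 4) `^ p; have C00 : 0 < C0 by rewrite powR_gt0; lra.
have [d d0 dP] : exists2 d : R, 0 < d &
    forall x, `|x - 1| < d -> `|x `^ p - 1| < eps * C0 / 4.
  by apply: powR_near1; rewrite !mulr_gt0 ?invr_gt0.
(* Since [disc_dist z z0 <= 2 * r], these bounds ensure in turn [disc_dist z z0 <= 1 / 16],
   [|disc_ratio z z0 - 1| <= 6 * r < d], and [64 * disc_dist z z0 <= eps * C0 / 4]. *)
pose r := Num.min (1 / 32) (Num.min (d / 7) (eps * C0 / 512)).
have r0 : 0 < r.
  rewrite !lt_min; apply/and3P; split; first lra.
    by rewrite divr_gt0.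
  by have := mulr_gt0 eps0 C00; lra.
have r32 : r <= 1 / 32 by rewrite ge_min lexx.
have rd : r <= d / 7 by rewrite !ge_min lexx orbT.
have re : r <= eps * C0 / 512 by rewrite !ge_min lexx !orbT.
pose G := r ^+ 2 / (a * (1 + r) ^+ 2).
have den : 0 < a * (1 + r) ^+ 2 by rewrite mulr_gt0 ?exprn_gt0; lra.
have G0 : 0 < G by rewrite divr_gt0 ?exprn_gt0.
have G1 : G <= 1 by rewrite ler_pdivrMr// mul1r !expr2; nra.
(* Perturbing and then normalizing each cost at most [c], so [2 * c = eps / 2] in all. *)
pose c := eps / 4; have c0 : 0 < c by rewrite divr_gt0.
(* [G] is the gap of the peak at distance [r]; [c * G] is the loss at [z] that the perturbation can
   compensate. *)
exists (c * G) => [|f lam z [fA fn1] lam1 z1 fz].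
  by rewrite mulr_gt0//= /c; nra.
have [[fd _] _] := fA.
have f_le (w : Cplx R) : unit_disc R w -> vdisc p w * rnorm (f w) <= 1.
  by apply: le_wnorm; rewrite fn1.
have vz := vdisc_gt0 p z1.
have fz0 : 0 < rnorm (f z).
  have cG : c * G < 1 by rewrite /c; nra.
  by rewrite -(pmulr_rgt0 _ vz); lra.
have [] := @perturb_attains R F p a r c q f z hp a1 qE r0 _ c0 _ z1 fz0 fz.
- lra.
- by move=> w w1; split; [exact: fd|exact: f_le].
pose u := (rnorm (f z))^-1%:C *: f z.
pose f1 := fun w : Cplx R => f w + (c%:C * peak z p a q w) *: u.
rewrite -/u -/f1 => z0 [z01 zz0 f1z0 f1max].
set m := vdisc p z0 * rnorm (f1 z0) in f1z0 f1max.
have pk (w : Cplx R) : unit_disc R w -> vdisc p w * rnorm (peak z p a q w) <= 1.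
  move=> w1; have := @peak_le R z z1 p a q hp a1 w 0 qE w1.
  by rewrite lexx disc_dist_ge0// expr0n mul0r subr0; apply.
have u1 : rnorm u = 1.
  by rewrite rnormZ rnorm_real gtr0_norm ?invr_gt0// mulVf ?gt_eqF.
have f1_le (w : Cplx R) : unit_disc R w ->
    vdisc p w * rnorm (f1 w - f w) <= c.
  move=> w1; rewrite /f1 addrAC subrr add0r rnormZ u1 mulr1 rnormM rnorm_real.
  by rewrite gtr0_norm// mulrCA ler_piMr ?(ltW c0)// pk.
have m1 : 1 < m by apply: lt_le_trans f1z0; nra.
have mc : m <= 1 + c.
  have := f1_le _ z01; have := f_le _ z01; have := vdisc_gt0 p z01.
  have := rnormD (f1 z0 - f z0) (f z0); rewrite subrK /m.
  by move=> h v0 h1 h2; apply: le_trans (ler_wpM2l (ltW v0) h) _; rewrite mulrDr; lra.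
have m0 : 0 < m by lra.
pose f0 := fun w => (m^-1)%:C *: f1 w.
have f0E w : rnorm (f0 w) = m^-1 * rnorm (f1 w).
  by rewrite rnormZ rnorm_real gtr0_norm// invr_gt0.
have f0z0 : vdisc p z0 * rnorm (f0 z0) = 1.
  by rewrite f0E mulrCA mulVf// gt_eqF.
have f0_le w : unit_disc R w -> vdisc p w * rnorm (f0 w) <= 1.
  by move=> w1; rewrite f0E mulrCA ler_pdivrMl// mulr1 f1max.
exists f0, lam, z0; split; split=> //.
- split.
  + apply: (@HinfK_perturb R F (unit_disc R) (vdisc p) f (peak z p a q) c m^-1 u 1 fA).
    * by move=> w w1; apply: peak_differentiable.
    * by move=> w w1; apply/ltW/vdisc_gt0.
    * exact: pk.
    * exact: f0_le.
  + apply/eqP; rewrite eq_le wnorm_le//= -f0z0.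
    by apply: ereal_sup_ubound; exists z0.
- apply: (@le_lt_trans _ _ (2 * c)%:E); last by rewrite lte_fin /c; lra.
  apply: wnorm_le => w w1 /=.
  (* The first term has weighted norm at most [(1 - m^-1) * m = m - 1 <= c], the second at most
     [c]. *)
  have -> : f w - f0 w = (1 - m^-1)%:C *: f1 w - (f1 w - f w).
    by rewrite rmorphB rmorph1 scalerBl scale1r opprB [RHS]addrC addrA subrK.
  have v0 := vdisc_gt0 p w1.
  apply: le_trans (ler_wpM2l (ltW v0) (rnormB _ _)) _.
  rewrite mulrDr mulr_natl mulr2n lerD ?f1_le// rnormZ rnorm_real mulrCA.
  have m11 : 0 <= 1 - m^-1 by rewrite subr_ge0 invf_le1 ?ltW.
  rewrite ger0_norm//; apply: le_trans (ler_wpM2l m11 (f1max w w1)) _.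
  by rewrite mulrBl mul1r mulVf ?gt_eqF//; lra.
- apply: (@le_lt_trans _ _ (eps / 2)%:E); last by rewrite lte_fin; lra.
  apply: ge_ereal_sup => _ [g [[gd _] gn] <-]; rewrite lee_fin /evalf -!mulrA -mulrBr.
  rewrite rnormM lam1 mul1r.
  have e16 : disc_dist z z0 <= 1 / 16 by lra.
  apply: le_trans (@weighted_delta_close R p z z0 g hp z1 e16 _) _.
    by move=> w w1; split; [exact: gd|exact: (le_wnorm gn)].
  rewrite -/C0 ler_pdivrMr//.
  have := disc_ratio_near z1 (le_trans e16 _); move=> /(_ ltac:(lra)) X1.
  have e0 := disc_dist_ge0 z1 z0.
  have := dP (disc_ratio z z0); move=> /(_ ltac:(lra)).
  have -> : eps / 2 * C0 = eps * C0 / 2 by rewrite mulrAC.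
  by move: re zz0; lra.
Qed.
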